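(* Let $\lambda>0$ and $0<\phi<\pi$. For all real $x$ and all real $t$, $$\exp\left(2ix\,\operatorname{arcsinh}\left(\frac t2\right)\right)=\sum_{n=0}^\infty\left(\frac{it}{2\sin\phi}\right)^n\left(\frac{\sin\phi}{\sin\left(\phi+i\,\operatorname{arcsinh}\left(\frac t2\right)\right)}\right)^{2\lambda+n}P_n^{(\lambda)}(x;\phi).$$
   Context: The Meixner--Pollaczek polynomials $P_n^{(\lambda)}(x;\phi)$ are defined by $$P_n^{(\lambda)}(x;\phi)=e^{in\phi}\sum_{k=0}^n\frac{(\lambda+ix)_k(\lambda-ix)_{n-k}}{k!\,(n-k)!}e^{-2ik\phi},$$ where $(\alpha)_0=1$, $(\alpha)_k=\alpha(\alpha+1)\cdots(\alpha+k-1)$. Equivalently, for $|s|<1$, $\sum_{n\ge0}P_n^{(\lambda)}(x;\phi)s^n=(1-se^{i\phi})^{-(\lambda-ix)}(1-se^{-i\phi})^{-(\lambda+ix)}$ with principal branches. Complex powers are principal (the ratio $\sin\phi/\sin(\phi+i\,\operatorname{arcsinh}(t/2))$ has positive real part for real $t$). *)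

(* Defs.v *)
(* Real numbers of Stdlib; complex numbers and series of Coquelicot. *)
From Stdlib Require Export Reals Factorial.
From Coquelicot Require Export Coquelicot.
Open Scope R_scope.

(* e^(a+ib) = e^a (cos b + i sin b) *)
Definition Cexp (z : C) : C := (exp (Re z) * cos (Im z), exp (Re z) * sin (Im z)).

Definition Csin (z : C) : C :=
  ((Cexp (Ci * z) - Cexp (- (Ci * z))) / (2 * Ci))%C.

(* Principal argument, in (-PI, PI]; a junk value at z = 0. *)
Definition Carg (z : C) : R :=
  if Rle_dec 0 (Im z) then acos (Re z / Cmod z) else - acos (Re z / Cmod z).

(* Principal branch; only meaningful for z <> 0. *)
Definition Clog (z : C) : C := (ln (Cmod z), Carg z).

(* Principal power z^w; only meaningful for z <> 0. *)
Definition Cpower (z w : C) : C := Cexp (w * Clog z)%C.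

Fixpoint rising (a : C) (k : nat) : C :=
  match k with
  | O => 1%C
  | S j => (rising a j * (a + INR j))%C
  end.

(* sum_n u n has the n + 1 terms u 0, ..., u n. *)
Definition meixner_pollaczek (lambda phi x : R) (n : nat) : C :=
  (Cexp (Ci * INR n * phi) *
   sum_n (fun k : nat =>
     rising (lambda + Ci * x) k * rising (lambda - Ci * x) (n - k)
       / (INR (fact k) * INR (fact (n - k)))
       * Cexp (- (2 * Ci * INR k * phi))) n)%C.

(* Main.v *)
From Stdlib Require Import Lra Lia.
Require Import Defs.

(** Put [u = arcsinh (t / 2)], [w = sin phi / sin (phi + i u)] and
    [s = i sinh u / sin (phi + i u)]. The [n]-th term is [w^(2 lambda) P_n s^n], and
    [|s| < 1] because [|sin (phi + i u)|^2 = sinh^2 u + sin^2 phi], so the generating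
    function applies. Since [1 - s e^(i phi) = w e^u] and [1 - s e^(-i phi) = w e^(-u)] with
    [Re w > 0], all powers of [w] cancel and [e^(2 i x u)] remains. The generating function is
    the Cauchy product of two binomial series with complex exponents. *)

(** * Complex series through real and imaginary parts *)

Lemma sum_n_pair (f : nat -> C) (n : nat) :
  sum_n f n = (sum_n (fun k => Re (f k)) n, sum_n (fun k => Im (f k)) n).
Proof.
  induction n as [|n IH].
  - rewrite !sum_O. apply surjective_pairing.
  - rewrite !sum_Sn, IH. reflexivity.
Qed.

(** Balls in [C] are products of real balls, so convergence can be tested on each coordinate. This
    brings the real theory of Cauchy products and power series to bear on complex series. *)
Lemma is_series_pair (f : nat -> C) (l : C) :
  is_series f l <->
  is_series (fun n => Re (f n)) (Re l) /\ is_series (fun n => Im (f n)) (Im l).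
Proof.
  unfold is_series. split.
  - intros H. split.
    + apply (filterlim_ext (fun n => Re (sum_n f n))).
      { intros n. now rewrite sum_n_pair. }
      intros P [e He]. apply (H (fun z => P (Re z))). exists e.
      intros y Hy. apply He, Hy.
    + apply (filterlim_ext (fun n => Im (sum_n f n))).
      { intros n. now rewrite sum_n_pair. }
      intros P [e He]. apply (H (fun z => P (Im z))). exists e.
      intros y Hy. apply He, Hy.
  - intros [H1 H2] P [e He].
    assert (K1 := H1 _ (locally_ball (Re l) e)).
    assert (K2 := H2 _ (locally_ball (Im l) e)).
    unfold filtermap in *.
    refine (filter_imp _ _ _ (filter_and _ _ K1 K2)).
    intros n [B1 B2]. apply He. rewrite sum_n_pair. now split.
Qed.

Lemma im_le_Cmod (c : C) : Rabs (Im c) <= Cmod c.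
Proof.
  apply Rle_trans with (2 := Rmax_Cmod c). apply Rmax_r.
Qed.

Lemma ex_series_Rabs_Re (a : nat -> C) :
  ex_series (fun n => Cmod (a n)) -> ex_series (fun n => Rabs (Re (a n))).
Proof.
  apply (ex_series_le (fun n => Rabs (Re (a n)))). intros n.
  unfold norm; simpl; unfold abs; simpl. rewrite Rabs_Rabsolu. apply re_le_Cmod.
Qed.

Lemma ex_series_Rabs_Im (a : nat -> C) :
  ex_series (fun n => Cmod (a n)) -> ex_series (fun n => Rabs (Im (a n))).
Proof.
  apply (ex_series_le (fun n => Rabs (Im (a n)))). intros n.
  unfold norm; simpl; unfold abs; simpl. rewrite Rabs_Rabsolu. apply im_le_Cmod.
Qed.

(** Four real Cauchy products, one for each pairing of coordinates, combine as in complex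
    multiplication; absolute convergence of the coordinates follows from that of the moduli. *)
Lemma is_series_Cmult (a b : nat -> C) (la lb : C) :
  is_series a la -> is_series b lb ->
  ex_series (fun n => Cmod (a n)) -> ex_series (fun n => Cmod (b n)) ->
  is_series (fun n => sum_n (fun k => (a k * b (n - k)%nat)%C) n) (la * lb)%C.
Proof.
  intros Ha Hb Aa Ab.
  apply is_series_pair in Ha. apply is_series_pair in Hb.
  destruct Ha as [Ha1 Ha2]. destruct Hb as [Hb1 Hb2].
  assert (Aa1 := ex_series_Rabs_Re a Aa). assert (Aa2 := ex_series_Rabs_Im a Aa).
  assert (Ab1 := ex_series_Rabs_Re b Ab). assert (Ab2 := ex_series_Rabs_Im b Ab).
  apply is_series_pair. split.
  - eapply is_series_ext.
    2: exact (is_series_minus _ _ _ _ (is_series_mult _ _ _ _ Ha1 Hb1 Aa1 Ab1)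
                (is_series_mult _ _ _ _ Ha2 Hb2 Aa2 Ab2)).
    intros n. rewrite sum_n_pair. simpl. rewrite sum_n_Reals.
    symmetry. apply (minus_sum (fun k => Re (a k) * Re (b (n - k)%nat))).
  - eapply is_series_ext.
    2: exact (is_series_plus _ _ _ _ (is_series_mult _ _ _ _ Ha1 Hb2 Aa1 Ab2)
                (is_series_mult _ _ _ _ Ha2 Hb1 Aa2 Ab1)).
    intros n. rewrite sum_n_pair. simpl. rewrite sum_n_Reals.
    symmetry. apply (plus_sum (fun k => Re (a k) * Im (b (n - k)%nat))).
Qed.

(** * Complex exponential, and principal logarithm on the right half-plane *)

Lemma Cexp_plus (z w : C) : Cexp (z + w)%C = (Cexp z * Cexp w)%C.
Proof.
  destruct z as [a b], w as [c d]. unfold Cexp, Cmult, Cplus; simpl.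
  rewrite exp_plus, cos_plus, sin_plus. f_equal; ring.
Qed.

Lemma Cexp_0 : Cexp 0 = 1.
Proof.
  unfold Cexp; simpl. rewrite exp_0, cos_0, sin_0. unfold RtoC. f_equal; ring.
Qed.

Lemma Cexp_neq_0 (z : C) : Cexp z <> 0.
Proof.
  intros H. apply (R1_neq_R0). apply RtoC_inj. rewrite <- Cexp_0.
  replace (RtoC 0) with (z + - z)%C by ring. rewrite Cexp_plus, H. ring.
Qed.

Lemma Cinv_unique (p q : C) : q <> 0 -> (p * q)%C = 1 -> p = (/ q)%C.
Proof.
  intros Hq H. replace p with (p * q * / q)%C by (field; exact Hq).
  rewrite H. ring.
Qed.

Lemma Cexp_opp (z : C) : Cexp (- z)%C = (/ Cexp z)%C.
Proof.
  apply Cinv_unique; [apply Cexp_neq_0|].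
  rewrite <- Cexp_plus, <- Cexp_0. f_equal. ring.
Qed.

Lemma Cexp_mult_INR (z : C) (n : nat) : Cexp (INR n * z)%C = Cpow (Cexp z) n.
Proof.
  induction n as [|n IH].
  - simpl. rewrite <- Cexp_0. f_equal. ring.
  - rewrite S_INR, RtoC_plus, Cpow_S, <- IH, <- Cexp_plus. f_equal. ring.
Qed.

Lemma Cexp_RtoC (x : R) : Cexp x = exp x.
Proof.
  unfold Cexp, RtoC; simpl. rewrite cos_0, sin_0. f_equal; ring.
Qed.

Lemma Cmod_sqr (z : C) : Cmod z ^ 2 = Re z ^ 2 + Im z ^ 2.
Proof.
  unfold Cmod. rewrite pow2_sqrt; [reflexivity|].
  assert (H1 := pow2_ge_0 (Re z)). assert (H2 := pow2_ge_0 (Im z)).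
  unfold Re, Im in *. lra.
Qed.

Lemma Cmod_pos_of_Re_pos (z : C) : 0 < Re z -> 0 < Cmod z.
Proof.
  intros H. apply Cmod_gt_0. intros E. rewrite E in H. simpl in H. lra.
Qed.

Lemma sqrt_1_plus_Im_over_Re_sqr (z : C) :
  0 < Re z -> sqrt (1 + Rsqr (Im z / Re z)) = Cmod z / Re z.
Proof.
  intros H. assert (Hm := Cmod_pos_of_Re_pos z H). assert (Hs := Cmod_sqr z).
  replace (1 + Rsqr (Im z / Re z)) with (Rsqr (Cmod z / Re z)).
  2:{ unfold Rsqr. field_simplify; try lra. rewrite Hs. field. lra. }
  apply sqrt_Rsqr, Rlt_le, Rdiv_lt_0_compat; assumption.
Qed.

(** On the right half-plane the two [acos] cases of [Carg] merge into a single [atan], a form that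
    can be differentiated across the real axis. *)
Lemma Clog_Re_pos (z : C) :
  0 < Re z -> Clog z = (/ 2 * ln (Re z ^ 2 + Im z ^ 2), atan (Im z / Re z)).
Proof.
  intros H.
  assert (Hm := Cmod_pos_of_Re_pos z H).
  assert (Hs := Cmod_sqr z).
  unfold Clog. f_equal.
  - rewrite <- Hs, ln_pow by exact Hm. simpl. field.
  - assert (Hc : cos (atan (Im z / Re z)) = Re z / Cmod z).
    { rewrite cos_atan, sqrt_1_plus_Im_over_Re_sqr by exact H. field. lra. }
    assert (B := atan_bound (Im z / Re z)).
    unfold Carg. rewrite <- Hc. destruct (Rle_dec 0 (Im z)) as [I|I].
    + apply acos_cos. split; [|lra].
      destruct I as [I|I].
      * rewrite <- atan_0. apply Rlt_le, atan_increasing, Rdiv_lt_0_compat; assumption.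
      * rewrite <- I. unfold Rdiv. rewrite Rmult_0_l, atan_0. lra.
    (* Here the angle is negative, so evenness of the cosine moves it into the range of [acos]. *)
    + rewrite <- cos_neg, acos_cos; [ring|]. split; [|lra].
      assert (atan (Im z / Re z) < atan 0); [|rewrite atan_0 in *; lra].
      apply atan_increasing.
      assert (0 < (- Im z) / Re z) by (apply Rdiv_lt_0_compat; lra).
      unfold Rdiv in *. lra.
Qed.

Lemma Cexp_Clog (z : C) : 0 < Re z -> Cexp (Clog z) = z.
Proof.
  intros H.
  assert (Hm := Cmod_pos_of_Re_pos z H).
  assert (Hq := sqrt_1_plus_Im_over_Re_sqr z H).
  assert (Hl : Re (Clog z) = ln (Cmod z)) by reflexivity.
  assert (Hi : Im (Clog z) = atan (Im z / Re z)) by (rewrite Clog_Re_pos by exact H; reflexivity).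
  unfold Cexp. rewrite Hl, Hi, exp_ln, cos_atan, sin_atan, Hq by exact Hm.
  apply injective_projections; simpl; fold (Re z) (Im z); field; lra.
Qed.

(** A positive real factor does not change the argument, so no multiple of [2 i PI] appears. *)
Lemma Clog_scal_exp (z : C) (u : R) :
  0 < Re z -> Clog (z * exp u)%C = (Clog z + u)%C.
Proof.
  intros H. assert (E := exp_pos u).
  rewrite (Clog_Re_pos z H), Clog_Re_pos.
  - destruct z as [a b]. unfold Cmult, Cplus, RtoC; simpl in *. f_equal.
    + replace ((a * exp u - b * 0) * ((a * exp u - b * 0) * 1) +
       (a * 0 + b * exp u) * ((a * 0 + b * exp u) * 1))
       with ((a * (a * 1) + b * (b * 1)) * (exp u * exp u)) by ring.
      assert (0 < a * (a * 1) + b * (b * 1)) by nra.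
      rewrite !ln_mult, ln_exp; try nra. 
    + rewrite Rplus_0_r. f_equal. field. lra.
  - destruct z as [a b]. simpl in *. nra.
Qed.

(** With [f = p + i q], [m = m1 + i m2] and [v = v1 + i v2], the hypotheses say [f' = v f] and
    [m' = - v], hence [f e^m] has derivative zero. Coordinates are used because the derivatives are
    those of real functions. *)
Lemma Cexp_integrating_factor (p q m1 m2 v1 v2 : R -> R) (a b : R) :
  a < b ->
  (forall r, a <= r <= b -> is_derive p r (v1 r * p r - v2 r * q r)) ->
  (forall r, a <= r <= b -> is_derive q r (v1 r * q r + v2 r * p r)) ->
  (forall r, a <= r <= b -> is_derive m1 r (- v1 r)) ->
  (forall r, a <= r <= b -> is_derive m2 r (- v2 r)) ->
  ((p a, q a) * Cexp (m1 a, m2 a))%C = ((p b, q b) * Cexp (m1 b, m2 b))%C.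
Proof.
  intros Hab Hp Hq H1 H2.
  unfold Cexp, Cmult; simpl. f_equal.
  - apply (eq_is_derive
      (fun r => p r * (exp (m1 r) * cos (m2 r)) - q r * (exp (m1 r) * sin (m2 r)))).
    2: assumption.
    intros r Hr. specialize (Hp r Hr). specialize (Hq r Hr).
    specialize (H1 r Hr). specialize (H2 r Hr).
    auto_derive.
    { repeat split; eexists; eassumption. }
    rewrite (is_derive_unique (fun r : R => p r) _ _ Hp), (is_derive_unique (fun r : R => q r) _ _ Hq),
      (is_derive_unique (fun r : R => m1 r) _ _ H1), (is_derive_unique (fun r : R => m2 r) _ _ H2).
    unfold zero; simpl. ring.
  - apply (eq_is_derive
      (fun r => p r * (exp (m1 r) * sin (m2 r)) + q r * (exp (m1 r) * cos (m2 r)))).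
    2: assumption.
    intros r Hr. specialize (Hp r Hr). specialize (Hq r Hr).
    specialize (H1 r Hr). specialize (H2 r Hr).
    auto_derive.
    { repeat split; eexists; eassumption. }
    rewrite (is_derive_unique (fun r : R => p r) _ _ Hp), (is_derive_unique (fun r : R => q r) _ _ Hq),
      (is_derive_unique (fun r : R => m1 r) _ _ H1), (is_derive_unique (fun r : R => m2 r) _ _ H2).
    unfold zero; simpl. ring.
Qed.

(** * Terms of the binomial series of [(1 - z)^(-a)] and their majorant *)

Definition binom_term (a z : C) (k : nat) : C :=
  (rising a k / INR (fact k) * Cpow z k)%C.

Lemma INR_C_neq_0 (n : nat) : n <> O -> RtoC (INR n) <> 0.
Proof.
  intros H E. apply RtoC_inj in E. revert E. now apply not_0_INR.
Qed.

Lemma binom_term_0 (a z : C) : binom_term a z 0 = 1.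
Proof.
  unfold binom_term. simpl. field.
Qed.

Lemma binom_term_S (a z : C) (k : nat) :
  (INR (S k) * binom_term a z (S k))%C = (z * (a + INR k) * binom_term a z k)%C.
Proof.
  unfold binom_term.
  replace (rising a (S k)) with (rising a k * (a + INR k))%C by reflexivity.
  rewrite Cpow_S, fact_simpl, mult_INR, RtoC_mult. field.
  split; apply INR_C_neq_0; [apply fact_neq_0|lia].
Qed.

Lemma Cmod_INR (n : nat) : Cmod (INR n) = INR n.
Proof.
  rewrite Cmod_R. apply Rabs_pos_eq, pos_INR.
Qed.

(** This is [A (A+1) ... (A+k-1) / k!], built from its successive ratios for use in the ratio
    test. *)
Fixpoint rising_majorant (A : R) (k : nat) : R :=
  match k with
  | O => 1
  | S j => rising_majorant A j * ((A + INR j) / INR (S j))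
  end.

Lemma rising_majorant_pos (A : R) (k : nat) : 0 < A -> 0 < rising_majorant A k.
Proof.
  intros H. induction k as [|k IH].
  - simpl; lra.
  - change (0 < rising_majorant A k * ((A + INR k) / INR (S k))).
    apply Rmult_lt_0_compat; [exact IH|]. apply Rdiv_lt_0_compat.
    + assert (K := pos_INR k). lra.
    + apply lt_0_INR. lia.
Qed.

(** Induction from [|a + k| <= |a| + k]. The added 1 keeps the parameter of the majorant positive
    when [a = 0], since the ratio test wants nonzero coefficients. *)
Lemma Cmod_binom_term (a z : C) (k : nat) :
  Cmod (binom_term a z k) <= rising_majorant (Cmod a + 1) k * Cmod z ^ k.
Proof.
  assert (P : 0 < Cmod a + 1) by (assert (H := Cmod_ge_0 a); lra).
  induction k as [|k IH].
  - rewrite binom_term_0, Cmod_1. simpl. lra.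
  - assert (N : 0 < INR (S k)) by (apply lt_0_INR; lia).
    apply (Rmult_le_reg_l (INR (S k))); [exact N|].
    rewrite <- (Cmod_INR (S k)) at 1. rewrite <- Cmod_mult, binom_term_S, !Cmod_mult.
    change (rising_majorant (Cmod a + 1) (S k)) with
      (rising_majorant (Cmod a + 1) k * ((Cmod a + 1 + INR k) / INR (S k))).
    simpl (Cmod z ^ S k).
    replace (INR (S k) * (rising_majorant (Cmod a + 1) k *
      ((Cmod a + 1 + INR k) / INR (S k)) * (Cmod z * Cmod z ^ k))) with
      ((Cmod z * (Cmod a + 1 + INR k)) * (rising_majorant (Cmod a + 1) k * Cmod z ^ k))
      by (field; lra).
    assert (Hz := Cmod_ge_0 z). assert (Ha := Cmod_ge_0 (a + INR k)%C).
    assert (T := Cmod_triangle a (INR k)). rewrite Cmod_INR in T.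
    apply Rmult_le_compat; [nra|apply Cmod_ge_0| |exact IH].
    apply Rmult_le_compat_l; lra.
Qed.

(** The ratio of consecutive terms is [(A + n) / (n + 1) = 1 + (A - 1) / (n + 1)], which tends to
    1. *)
Lemma CV_radius_rising_majorant (A : R) :
  0 < A -> CV_radius (rising_majorant A) = 1.
Proof.
  intros H. rewrite (CV_radius_finite_DAlembert _ 1).
  - now rewrite Rinv_1.
  - intros n. assert (K := rising_majorant_pos A n H). lra.
  - lra.
  - apply is_lim_seq_ext with (fun n => (A - 1) * / INR (S n) + 1).
    + intros n. assert (K := rising_majorant_pos A n H).
      change (rising_majorant A (S n)) with
        (rising_majorant A n * ((A + INR n) / INR (S n))).
      assert (N : 0 < INR (S n)) by (apply lt_0_INR; lia).
      assert (N' := pos_INR n).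
      rewrite Rabs_pos_eq.
      * rewrite S_INR in *. field. lra.
      * apply Rlt_le, Rdiv_lt_0_compat; [|exact K]. apply Rmult_lt_0_compat; [exact K|].
        apply Rdiv_lt_0_compat; lra.
    + replace (Finite 1) with (Rbar_plus (Rbar_mult (A - 1) 0) 1)
        by (simpl; f_equal; ring).
      apply is_lim_seq_plus'; [|apply is_lim_seq_const].
      replace (Finite ((A - 1) * 0)) with (Rbar_mult (A - 1) 0) by reflexivity.
      apply is_lim_seq_scal_l.
      apply (is_lim_seq_incr_1 (fun n => / INR n)).
      replace (Finite 0) with (Rbar_inv p_infty) by reflexivity.
      apply is_lim_seq_inv; [apply is_lim_seq_INR|discriminate].
Qed.

Lemma ex_series_rising_majorant (A y : R) :
  0 < A -> 0 <= y < 1 -> ex_series (fun k => rising_majorant A k * y ^ k).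
Proof.
  intros HA Hy.
  apply ex_series_Rabs, CV_disk_inside.
  rewrite CV_radius_rising_majorant by exact HA. simpl. rewrite Rabs_pos_eq; lra.
Qed.

Lemma ex_series_Cmod_binom_term (a z : C) :
  Cmod z < 1 -> ex_series (fun k => Cmod (binom_term a z k)).
Proof.
  intros H.
  apply (ex_series_le (fun k => Cmod (binom_term a z k))
           (fun k => rising_majorant (Cmod a + 1) k * Cmod z ^ k)).
  - intros k. unfold norm; simpl; unfold abs; simpl.
    rewrite Rabs_pos_eq by apply Cmod_ge_0. apply Cmod_binom_term.
  - assert (K := Cmod_ge_0 a). assert (K' := Cmod_ge_0 z).
    apply ex_series_rising_majorant; lra.
Qed.

(* [CV_radius] is real, hence applied to [Re] and [Im] of the terms; any [r > 1] with
   [|z| r < 1] keeps [c k * r^k] bounded. *)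
Lemma CV_radius_gt_1_of_binom_term (a z : C) (c : nat -> R) :
  Cmod z < 1 -> (forall k, Rabs (c k) <= Cmod (binom_term a z k)) ->
  Rbar_lt 1 (CV_radius c).
Proof.
  intros Hz Hc. assert (Ha := Cmod_ge_0 a). assert (Hz0 := Cmod_ge_0 z).
  (* The inverse of the midpoint of [|z|] and 1: it exceeds 1, and [|z| r] stays below 1. *)
  set (r := 2 / (1 + Cmod z)).
  assert (Hr : 1 < r) by (unfold r; apply Rlt_div_r; lra).
  assert (Hy : Cmod z * r < 1).
  { unfold r. replace (Cmod z * (2 / (1 + Cmod z))) with (2 * Cmod z / (1 + Cmod z))
      by (field; lra). apply Rlt_div_l; lra. }
  apply Rbar_lt_le_trans with r; [exact Hr|].
  apply (proj1 (CV_radius_bounded c)).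
  assert (S : ex_series (fun k => rising_majorant (Cmod a + 1) k * (Cmod z * r) ^ k)).
  { apply ex_series_rising_majorant; nra. }
  destruct (filterlim_bounded (K := R_AbsRing) (V := R_NormedModule)
    (fun k => rising_majorant (Cmod a + 1) k * (Cmod z * r) ^ k)) as [M HM].
  { exists 0. apply (ex_series_lim_0 _ S). }
  exists M. intros n. apply Rle_trans with (2 := HM n).
  unfold norm; simpl; unfold abs; simpl.
  rewrite Rpow_mult_distr, <- Rmult_assoc, Rabs_mult.
  rewrite (Rabs_mult _ (r ^ n)).
  apply Rmult_le_compat_r; [apply Rabs_pos|].
  apply Rle_trans with (1 := Hc n). apply Rle_trans with (2 := Rle_abs _).
  apply Cmod_binom_term.
Qed.

(** * Summing the binomial series by a differential equation *)

(** Summing the recurrence against [r^k] turns the factor [k] into [r d/dr]. This gives the real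
    part of [f' = b f + z r f']; exchanging [c1] and [c2] and negating [b2] and [z2] gives the
    imaginary part. *)
Lemma PSeries_ode (c1 c2 : nat -> R) (b1 b2 z1 z2 r : R) :
  Rbar_lt (Rabs r) (CV_radius c1) -> Rbar_lt (Rabs r) (CV_radius c2) ->
  (forall k, PS_derive c1 k =
     b1 * c1 k - b2 * c2 k + (z1 * (INR k * c1 k) - z2 * (INR k * c2 k))) ->
  PSeries (PS_derive c1) r =
    b1 * PSeries c1 r - b2 * PSeries c2 r +
    (z1 * (r * PSeries (PS_derive c1) r) - z2 * (r * PSeries (PS_derive c2) r)).
Proof.
  intros R1 R2 H.
  assert (E : forall c, Rbar_lt (Rabs r) (CV_radius c) ->
    is_series (fun k => c k * r ^ k) (PSeries c r)).
  { intros c Hc. apply is_pseries_R, PSeries_correct, CV_radius_inside, Hc. }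
  assert (D : forall c, Rbar_lt (Rabs r) (CV_radius c) ->
    is_series (fun k => INR k * c k * r ^ k) (r * PSeries (PS_derive c) r)).
  { intros c Hc. rewrite <- PSeries_incr_1.
    apply (is_series_ext (fun k => PS_incr_1 (PS_derive c) k * r ^ k)).
    (* At index 0 the shifted series has coefficient zero, matching the factor [INR 0]. *)
    - intros [|k]; unfold PS_incr_1, PS_derive; [|reflexivity].
      unfold zero; simpl; ring.
    - apply E. rewrite CV_radius_incr_1, CV_radius_derive. exact Hc. }
  apply is_series_unique.
  apply (is_series_ext (fun k => plus
     (minus (scal b1 (c1 k * r ^ k)) (scal b2 (c2 k * r ^ k)))
     (minus (scal z1 (INR k * c1 k * r ^ k)) (scal z2 (INR k * c2 k * r ^ k))))).
  { intros k. rewrite H. unfold plus, minus, scal, opp, plus; simpl.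
    unfold mult; simpl. ring. }
  apply (is_series_plus (V := R_NormedModule)); apply (is_series_minus (V := R_NormedModule));
    apply (is_series_scal (V := R_NormedModule)); auto.
Qed.

Lemma PS_derive_pair (f : nat -> C) (k : nat) :
  (INR (S k) * f (S k))%C =
  (PS_derive (fun n => Re (f n)) k, PS_derive (fun n => Im (f n)) k).
Proof.
  unfold PS_derive. apply injective_projections; simpl; fold (Re (f (S k))) (Im (f (S k))); ring.
Qed.

(* On the real ray [r |-> r z], the series [f] satisfies [(1 - r z) f' = a z f], while
   [(1 - r z)^a] has logarithmic derivative [- a z / (1 - r z)]; so their product is constant. *)
Lemma is_series_binom (a z : C) :
  Cmod z < 1 -> is_series (binom_term a z) (Cpower (1 - z) (- a)).
Proof.
  intros Hz.
  set (c1 := fun k => Re (binom_term a z k)).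
  set (c2 := fun k => Im (binom_term a z k)).
  (* A radius beyond 1 puts the endpoint [r = 1] inside the disk, so the series is differentiable on
     all of [[0, 1]]. *)
  assert (R1 : Rbar_lt 1 (CV_radius c1)).
  { apply CV_radius_gt_1_of_binom_term with a z; [exact Hz|]. intros k; apply re_le_Cmod. }
  assert (R2 : Rbar_lt 1 (CV_radius c2)).
  { apply CV_radius_gt_1_of_binom_term with a z; [exact Hz|]. intros k; apply im_le_Cmod. }
  assert (Hin : forall c, Rbar_lt 1 (CV_radius c) -> forall r, 0 <= r <= 1 ->
    Rbar_lt (Rabs r) (CV_radius c)).
  { intros c Hc r Hr. apply Rbar_le_lt_trans with 1; [|exact Hc].
    simpl. rewrite Rabs_pos_eq; lra. }
  assert (Hx := re_le_Cmod z).
  assert (Hrec : forall k,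
    PS_derive c1 k = Re (z * a) * c1 k - Im (z * a) * c2 k
      + (Re z * (INR k * c1 k) - Im z * (INR k * c2 k)) /\
    PS_derive c2 k = Re (z * a) * c2 k - (- Im (z * a)) * c1 k
      + (Re z * (INR k * c2 k) - (- Im z) * (INR k * c1 k))).
  { intros k. assert (E := binom_term_S a z k). rewrite PS_derive_pair in E.
    fold c1 c2 in E.
    split; [apply (f_equal fst) in E | apply (f_equal snd) in E]; simpl in E;
      rewrite E; unfold c1, c2, Re, Im; simpl; ring. }
  set (z1 := Re z) in *. set (z2 := Im z) in *.
  set (a1 := Re a). set (a2 := Im a).
  set (b1 := Re (z * a)) in *. set (b2 := Im (z * a)) in *.
  assert (Eb1 : b1 = z1 * a1 - z2 * a2) by reflexivity.
  assert (Eb2 : b2 = z1 * a2 + z2 * a1) by reflexivity.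
  (* The segment from 1 to [1 - z] stays in the right half-plane, where [Clog_Re_pos] applies. *)
  assert (Hd : forall r, 0 <= r <= 1 -> 0 < 1 - z1 * r).
  { intros r Hr. assert (K := Rle_abs z1).
    destruct (Rlt_dec r 1); [nra|]. replace r with 1 by lra. lra. }
  set (D := fun r => (1 - z1 * r) ^ 2 + (- (z2 * r)) ^ 2).
  assert (HD : forall r, 0 <= r <= 1 -> 0 < D r).
  { intros r Hr. assert (K := Hd r Hr). unfold D. nra. }
  (* The solved equation [f' = z a f / (1 - r z)], with the quotient made real by the conjugate of
     [1 - r z]; [D r] is [|1 - r z|^2]. *)
  assert (Hode : forall r, 0 <= r <= 1 ->
    PSeries (PS_derive c1) r = (b1 * (1 - z1 * r) - b2 * (z2 * r)) / D r * PSeries c1 r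
      - (b2 * (1 - z1 * r) + b1 * (z2 * r)) / D r * PSeries c2 r /\
    PSeries (PS_derive c2) r = (b1 * (1 - z1 * r) - b2 * (z2 * r)) / D r * PSeries c2 r
      + (b2 * (1 - z1 * r) + b1 * (z2 * r)) / D r * PSeries c1 r).
  { intros r Hr. assert (K := HD r Hr).
    assert (E1 := PSeries_ode c1 c2 b1 b2 z1 z2 r (Hin _ R1 r Hr) (Hin _ R2 r Hr)
      (fun k => proj1 (Hrec k))).
    assert (E2 := PSeries_ode c2 c1 b1 (- b2) z1 (- z2) r (Hin _ R2 r Hr) (Hin _ R1 r Hr)
      (fun k => proj2 (Hrec k))).
    revert E1 E2.
    generalize (PSeries (PS_derive c1) r) (PSeries (PS_derive c2) r)
      (PSeries c1 r) (PSeries c2 r). intros p' q' p q E1 E2.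
    assert (F1 : (1 - z1 * r) * p' + z2 * r * q' = b1 * p - b2 * q) by lra.
    assert (F2 : (1 - z1 * r) * q' - z2 * r * p' = b1 * q + b2 * p) by lra.
    split; apply (Rmult_eq_reg_l (D r)); try lra.
    - transitivity ((1 - z1 * r) * ((1 - z1 * r) * p' + z2 * r * q')
        - z2 * r * ((1 - z1 * r) * q' - z2 * r * p')); [unfold D; ring|].
      rewrite F1, F2. field. lra.
    - transitivity ((1 - z1 * r) * ((1 - z1 * r) * q' - z2 * r * p')
        + z2 * r * ((1 - z1 * r) * p' + z2 * r * q')); [unfold D; ring|].
      rewrite F1, F2. field. lra. }
  (* [L1] and [L2] are the coordinates of [Clog (1 - r z)]. *)
  set (L1 := fun r => / 2 * ln (D r)).
  set (L2 := fun r => atan (- (z2 * r) / (1 - z1 * r))).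
  assert (HL1 : forall r, 0 <= r <= 1 ->
    is_derive L1 r (- (z1 * (1 - z1 * r) - z2 * (z2 * r)) / D r)).
  { intros r Hr. assert (K := HD r Hr). unfold L1, D in *. auto_derive.
    - exact K.
    - field. lra. }
  assert (HL2 : forall r, 0 <= r <= 1 ->
    is_derive L2 r (- (z2 * (1 - z1 * r) + z1 * (z2 * r)) / D r)).
  { intros r Hr. assert (K := HD r Hr). assert (K' := Hd r Hr).
    unfold L2, D in *. auto_derive.
    - lra.
    - field. split; lra. }
  assert (HL : forall r, 0 <= r <= 1 ->
    (a1 * L1 r - a2 * L2 r, a1 * L2 r + a2 * L1 r) = (a * Clog (1 - r * z))%C).
  { intros r Hr.
    assert (Er : Re (1 - r * z)%C = 1 - z1 * r) by (unfold z1, Re; simpl; ring).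
    assert (Ei : Im (1 - r * z)%C = - (z2 * r)) by (unfold z2, Im; simpl; ring).
    rewrite Clog_Re_pos by (rewrite Er; auto). rewrite Er, Ei. reflexivity. }
  assert (Hmain : ((PSeries c1 0, PSeries c2 0) * Cexp (a * Clog (1 - 0 * z)))%C =
    ((PSeries c1 1, PSeries c2 1) * Cexp (a * Clog (1 - 1 * z)))%C).
  { rewrite <- !HL by lra.
    apply (Cexp_integrating_factor (PSeries c1) (PSeries c2)
      (fun r => a1 * L1 r - a2 * L2 r) (fun r => a1 * L2 r + a2 * L1 r)
      (fun r => (b1 * (1 - z1 * r) - b2 * (z2 * r)) / D r)
      (fun r => (b2 * (1 - z1 * r) + b1 * (z2 * r)) / D r) 0 1 Rlt_0_1).
    - intros r Hr. rewrite <- (proj1 (Hode r Hr)). apply is_derive_PSeries, Hin; assumption.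
    - intros r Hr. rewrite <- (proj2 (Hode r Hr)). apply is_derive_PSeries, Hin; assumption.
    - intros r Hr. specialize (HD r Hr). eapply eq_ind.
      + apply (is_derive_minus (V := R_NormedModule));
          apply (is_derive_scal (fun r => _)); [apply HL1|apply HL2]; exact Hr.
      + rewrite Eb1, Eb2. unfold minus, plus, opp; simpl. field. lra.
    - intros r Hr. specialize (HD r Hr). eapply eq_ind.
      + apply (is_derive_plus (V := R_NormedModule));
          apply (is_derive_scal (fun r => _)); [apply HL2|apply HL1]; exact Hr.
      + rewrite Eb1, Eb2. unfold plus; simpl. field. lra. }
  assert (Hs : is_series (binom_term a z) (PSeries c1 1, PSeries c2 1)).
  { apply is_series_pair. split; cbn [Re Im fst snd].
    - apply (is_series_ext (fun k => c1 k * 1 ^ k)).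
      + intros k. rewrite pow1. apply Rmult_1_r.
      + apply is_pseries_R, PSeries_correct, CV_radius_inside, Hin; [exact R1|lra].
    - apply (is_series_ext (fun k => c2 k * 1 ^ k)).
      + intros k. rewrite pow1. apply Rmult_1_r.
      + apply is_pseries_R, PSeries_correct, CV_radius_inside, Hin; [exact R2|lra]. }
  replace (Cpower (1 - z) (- a)) with (PSeries c1 1, PSeries c2 1); [exact Hs|].
  (* At [r = 0] the constant product equals 1, so the sum at [r = 1] is the inverse of
     [Cexp (a * Clog (1 - z))]. *)
  rewrite !PSeries_0 in Hmain. 
  replace (c1 O, c2 O) with (RtoC 1) in Hmain
    by (unfold c1, c2; rewrite binom_term_0; reflexivity).
  replace (1 - 1 * z)%C with (1 - z)%C in Hmain by ring.
  replace (a * Clog (1 - 0 * z))%C with (RtoC 0) in Hmain.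
  2:{ replace (1 - 0 * z)%C with (RtoC 1) by ring.
      rewrite Clog_Re_pos by (simpl; lra). simpl.
      replace (1 * (1 * 1) + 0 * (0 * 1)) with 1 by ring.
      replace (0 / 1) with 0 by field. rewrite ln_1, atan_0, Rmult_0_r.
      change (0, 0) with (RtoC 0). ring. }
  rewrite Cexp_0 in Hmain.
  unfold Cpower. replace (- a * Clog (1 - z))%C with (- (a * Clog (1 - z)))%C by ring.
  rewrite Cexp_opp. apply Cinv_unique; [apply Cexp_neq_0|].
  rewrite Cmult_1_l in Hmain. now symmetry.
Qed.

(** * The generating function of the Meixner-Pollaczek polynomials *)

Lemma Cexp_Ci (x : R) : Cexp (Ci * x) = (cos x, sin x).
Proof.
  unfold Cexp; simpl.
  replace (0 * x - 1 * 0) with 0 by ring. replace (0 * 0 + 1 * x) with x by ring.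
  rewrite exp_0. f_equal; ring.
Qed.

Lemma Cmod_Cexp_Ci (x : R) : Cmod (Cexp (Ci * x)) = 1.
Proof.
  rewrite Cexp_Ci. unfold Cmod; cbn [fst snd].
  replace (cos x ^ 2 + sin x ^ 2) with 1; [apply sqrt_1|].
  rewrite <- (sin2_cos2 x). unfold Rsqr. ring.
Qed.

(** The two binomial series have parameters [lambda + i x] at [s e^(-i phi)] and [lambda - i x] at
    [s e^(i phi)]; both points have modulus [|s|]. *)
Lemma is_series_meixner_pollaczek (lambda phi x : R) (s : C) :
  Cmod s < 1 ->
  is_series (fun n => meixner_pollaczek lambda phi x n * Cpow s n)%C
    (Cpower (1 - s * Cexp (- (Ci * phi))) (- (lambda + Ci * x)) *
     Cpower (1 - s * Cexp (Ci * phi)) (- (lambda - Ci * x)))%C.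
Proof.
  intros Hs.
  assert (H1 : Cmod (s * Cexp (- (Ci * phi))) < 1).
  { replace (- (Ci * phi))%C with (Ci * (- phi)%R)%C by (rewrite RtoC_opp; ring).
    rewrite Cmod_mult, Cmod_Cexp_Ci. lra. }
  assert (H2 : Cmod (s * Cexp (Ci * phi)) < 1).
  { rewrite Cmod_mult, Cmod_Cexp_Ci. lra. }
  eapply is_series_ext.
  2: exact (is_series_Cmult _ _ _ _ (is_series_binom _ _ H1) (is_series_binom _ _ H2)
      (ex_series_Cmod_binom_term _ _ H1) (ex_series_Cmod_binom_term _ _ H2)).
  intros n. unfold meixner_pollaczek.
  rewrite <- Cmult_assoc, (Cmult_comm (sum_n _ _)), Cmult_assoc.
  rewrite <- (sum_n_mult_l (K := C_Ring)).
  apply sum_n_ext_loc. intros k Hk.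
  assert (En : n = (k + (n - k))%nat) by lia.
  (* Writing [n = k + m] removes the truncated subtraction. *)
  set (m := (n - k)%nat) in *. clearbody m. subst n. clear Hk.
  unfold mult; simpl. unfold binom_term.
  set (E := Cexp (Ci * phi)). set (F := Cexp (- (Ci * phi))).
  assert (EF : (E * F)%C = 1).
  { unfold E, F. rewrite <- Cexp_plus, <- Cexp_0. f_equal. ring. }
  replace (Cexp (Ci * INR (k + m) * phi)) with (Cpow E (k + m)).
  2:{ unfold E. rewrite <- Cexp_mult_INR. f_equal. ring. }
  replace (Cexp (- (2 * Ci * INR k * phi))) with (Cpow F k * Cpow F k)%C.
  2:{ unfold F. rewrite <- Cexp_mult_INR, <- Cexp_plus. f_equal. ring. }
  rewrite !Cpow_mult_l, !Cpow_add_r.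
  assert (EFk : (Cpow E k * Cpow F k)%C = 1).
  { rewrite <- Cpow_mult_l, EF. apply Cpow_1_l. }
  assert (K1 := INR_C_neq_0 _ (fact_neq_0 k)).
  assert (K2 := INR_C_neq_0 _ (fact_neq_0 m)).
  set (r1 := rising (lambda + Ci * x) k). set (r2 := rising (lambda - Ci * x) m).
  (* The prefactor contributes [E^(k+m) F^(2k)] and the product of the series only [F^k E^m]; the
     difference is [(E F)^k = 1]. *)
  transitivity ((Cpow E k * Cpow F k) *
    (r1 / INR (fact k) * (Cpow s k * Cpow F k) * (r2 / INR (fact m) * (Cpow s m * Cpow E m))))%C.
  - rewrite EFk. ring.
  - field. now split.
Qed.

(** * Hyperbolic identities and the substitution for [s] *)

Lemma Csin_plus_Ci (phi u : R) :
  Csin (phi + Ci * u) = (sin phi * cosh u, cos phi * sinh u).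
Proof.
  unfold Csin.
  replace (Ci * (phi + Ci * u))%C with ((- u)%R + Ci * phi)%C.
  2:{ apply injective_projections; simpl; ring. }
  replace (- ((- u)%R + Ci * phi))%C with (u + Ci * (- phi)%R)%C.
  2:{ apply injective_projections; simpl; ring. }
  rewrite !Cexp_plus, !Cexp_RtoC, !Cexp_Ci, cos_neg, sin_neg.
  unfold sinh, cosh. apply injective_projections; simpl; field.
Qed.

Lemma cosh_sqr (u : R) : cosh u ^ 2 = 1 + sinh u ^ 2.
Proof.
  assert (H : exp u * exp (- u) = 1).
  { rewrite <- exp_plus, Rplus_opp_r. apply exp_0. }
  unfold cosh, sinh. nra.
Qed.

Theorem mainTheorem2 (lambda phi : R) (hlambda : 0 < lambda) (hphi : 0 < phi < PI)
    (x t : R) :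
  is_series
    (fun n : nat =>
       (Cpow (Ci * t / (2 * sin phi)) n
        * Cpower (sin phi / Csin (phi + Ci * arcsinh (t / 2))) (2 * lambda + INR n)
        * meixner_pollaczek lambda phi x n)%C)
    (Cexp (2 * Ci * x * arcsinh (t / 2))%C).
Proof.
  assert (Ht : t = 2 * sinh (arcsinh (t / 2))) by (rewrite sinh_arcsinh; field).
  set (u := arcsinh (t / 2)) in *. clearbody u. subst t.
  assert (Hsin : 0 < sin phi) by (apply sin_gt_0; tauto).
  assert (Hch := cosh_sqr u).
  assert (Hch0 : 0 < cosh u).
  { unfold cosh. assert (P := exp_pos u). assert (Q := exp_pos (- u)). lra. }
  set (S := Csin (phi + Ci * u)).
  assert (ES : S = (sin phi * cosh u, cos phi * sinh u)) by apply Csin_plus_Ci.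
  assert (HS2 : Cmod S ^ 2 = sinh u ^ 2 + sin phi ^ 2).
  { rewrite Cmod_sqr, ES. cbn [Re Im fst snd].
    rewrite !Rpow_mult_distr, Hch.
    assert (K := sin2_cos2 phi). unfold Rsqr in K.
    replace (cos phi ^ 2) with (1 - sin phi ^ 2) by (rewrite <- K; ring). ring. }
  assert (HS : 0 < Cmod S).
  { apply Cmod_gt_0. intros E. rewrite ES in E. apply (f_equal fst) in E. simpl in E.
    nra. }
  assert (HS0 : S <> 0) by now apply Cmod_gt_0.
  assert (Hsin0 : RtoC (sin phi) <> 0).
  { intros E. apply RtoC_inj in E. lra. }
  set (w := (sin phi / S)%C).
  assert (Hw : 0 < Re w).
  (* From [w = sin phi * conj S / |S|^2] and [Re S = sin phi cosh u]. *)
  { replace (Re w) with (sin phi * (sin phi * cosh u) / (Cmod S ^ 2)).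
    - apply Rdiv_lt_0_compat; [|nra].
      apply Rmult_lt_0_compat; [|apply Rmult_lt_0_compat]; assumption.
    - rewrite Cmod_sqr. rewrite Cmod_sqr in HS2.
      unfold w. rewrite ES in *. simpl in *. field. nra. }
  set (s := (Ci * sinh u / S)%C).
  assert (Hs : Cmod s < 1).
  { unfold s. rewrite Cmod_div, Cmod_mult, Cmod_R by exact HS0.
    replace (Cmod Ci) with 1.
    2:{ unfold Cmod; simpl. rewrite <- sqrt_1 at 1. f_equal. ring. }
    rewrite Rmult_1_l. apply Rlt_div_l; [exact HS|]. rewrite Rmult_1_l.
    (* By [HS2], [|S|^2] exceeds [sinh^2 u] by [sin^2 phi > 0], which makes the bound strict. *)
    assert (K := pow2_abs (sinh u)). assert (K' := Rabs_pos (sinh u)). nra. }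
  assert (EP : (1 - s * Cexp (Ci * phi))%C = (w * exp u)%C).
  { transitivity ((S - Ci * sinh u * Cexp (Ci * phi)) / S)%C.
    - unfold s. field. exact HS0.
    (* The imaginary part [cos phi sinh u] of [S] cancels, leaving [sin phi (cosh u + sinh u)]. *)
    - replace (S - Ci * sinh u * Cexp (Ci * phi))%C with (sin phi * exp u)%C.
      + unfold w. field. exact HS0.
      + rewrite ES, Cexp_Ci. unfold sinh, cosh.
        apply injective_projections; simpl; field. }
  assert (EM : (1 - s * Cexp (- (Ci * phi)))%C = (w * exp (- u))%C).
  { transitivity ((S - Ci * sinh u * Cexp (- (Ci * phi))) / S)%C.
    - unfold s. field. exact HS0.
    - replace (S - Ci * sinh u * Cexp (- (Ci * phi)))%C with (sin phi * exp (- u))%C.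
      + unfold w. field. exact HS0.
      + replace (- (Ci * phi))%C with (Ci * (- phi)%R)%C by (rewrite RtoC_opp; ring).
        rewrite ES, Cexp_Ci, cos_neg, sin_neg. unfold sinh, cosh.
        apply injective_projections; simpl; field. }
  assert (G := is_series_meixner_pollaczek lambda phi x s Hs).
  rewrite EP, EM in G. unfold Cpower in G at 1 2.
  rewrite !Clog_scal_exp, <- Cexp_plus, RtoC_opp in G by exact Hw.
  (* Multiplying by [w^(2 lambda)] cancels the [-2 lambda Clog w] in the exponent of the sum, where
     the terms in [lambda u] cancel each other and [2 i x u] survives. *)
  apply (is_series_scal (K := C_AbsRing) (V := C_NormedModule)
    (Cexp (2 * lambda * Clog w))) in G.
  unfold scal in G; simpl in G. unfold mult in G; simpl in G.
  rewrite <- Cexp_plus in G.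
  replace (2 * Ci * x * u)%C with
    (2 * lambda * Clog w + (- (lambda + Ci * x) * (Clog w + - u) +
     - (lambda - Ci * x) * (Clog w + u)))%C by ring.
  refine (is_series_ext _ _ _ _ G).
  intros n. unfold Cpower.
  (* The integer part of the exponent gives an ordinary power [w^n], which joins
     [(i t / (2 sin phi))^n] to form [s^n]. *)
  rewrite Cmult_plus_distr_r, Cexp_plus, Cexp_mult_INR, Cexp_Clog by exact Hw.
  replace (Cpow s n) with (Cpow (Ci * (2 * sinh u)%R / (2 * sin phi)) n * Cpow w n)%C.
  - lazymatch goal with |- ?a = ?b => change (@eq C a b) end. ring.
  - rewrite <- Cpow_mult_l. f_equal. unfold s, w. rewrite RtoC_mult. field. now split.
Qed.
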